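(* Consider the ONS-GLM online learner run on the losses $\ell_t$ of the generalized linear bandit setting in the context, and define $g_s:=\ell'(x_s^\top\theta_s,y_s)$. For any $\epsilon>0$ and $t\ge1$, $$\sum_{s=1}^t\ell_s(\theta_s)-\ell_s(\theta^* )\le\frac{1}{2\kappa}\sum_{s=1}^t g_s^2\|x_s\|^2_{A_s^{-1}}+2\kappa S^2\epsilon=:B_t^{\mathrm{ONS}},$$ where, with high probability, $B_t^{\mathrm{ONS}}=O\big(\frac{L^2+R^2\log t}{\kappa}d\log t\big)$ for all $t\ge1$. If $\max_{s\ge1}|\eta_s|\le\bar R$ with probability 1, then $B_t^{\mathrm{ONS}}=O\big(\frac{L^2+\bar R^2}{\kappa}d\log t\big)$.
   Context: Generalized linear bandit setting: fix $d\ge1$, $S>0$, $R>0$. Unknown $\theta^*\in\mathbb R^d$ with $\|\theta^*\|_2\le S$. $\mu:\mathbb R\to\mathbb R$ is $L$-Lipschitz on $[-S,S]$, continuously differentiable on $(-S,S)$, with $\inf_{z\in(-S,S)}\mu'(z)=\kappa>0$. At each round $t$, $x_t\in\mathbb R^d$ with $\|x_t\|_2\le1$ is chosen based on the past, and $y_t=\mu(x_t^\top\theta^* )+\eta_t$ with $\eta_t$ conditionally $R$-sub-Gaussian given $x_t$ and $\{(x_s,\eta_s)\}_{s<t}$. Let $m$ be an antiderivative of $\mu$, $\ell(z,y)=-yz+m(z)$, $\ell'(z,y)=\partial\ell/\partial z=-y+\mu(z)$, $\ell_t(\theta)=\ell(x_t^\top\theta,y_t)$. $\mathcal B_d(S)$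 is the Euclidean ball of radius $S$; $\|x\|_A=\sqrt{x^\top Ax}$. ONS-GLM with parameters $\kappa,\epsilon,S>0$: $A_0=\epsilon I$, $\theta_1\in\mathcal B_d(S)$ arbitrary; for $t=1,2,\dots$: output $\theta_t$, observe $x_t,y_t$, set $A_t=A_{t-1}+x_tx_t^\top$, $\theta'_{t+1}=\theta_t-\frac{\ell'(x_t^\top\theta_t,y_t)}{\kappa}A_t^{-1}x_t$, $\theta_{t+1}=\arg\min_{\theta\in\mathcal B_d(S)}\|\theta-\theta'_{t+1}\|^2_{A_t}$.
   Formalization: The two O-bounds on B_t are proved for all t ≥ 2 instead of t ≥ 1, since at t = 1 the right-hand side is 0 (log 1 = 0) while B_1 ≥ 2κS²ε > 0; the hidden constant depends only on S, ε and, for the high-probability bound, the confidence level. *)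

(* Defs.v *)
From HB Require Import structures.
From mathcomp Require Import all_boot all_order all_algebra.
From mathcomp Require Import all_classical all_reals all_analysis.
Set Implicit Arguments. Unset Strict Implicit. Unset Printing Implicit Defensive.
Import Order.TTheory GRing.Theory Num.Theory.
Import numFieldNormedType.Exports.
Local Open Scope classical_set_scope.
Local Open Scope ring_scope.

Section GLB.
Variables (R : realType) (d : nat).

Definition dotv (x y : 'cV[R]_d) : R := (x^T *m y) ord0 ord0.
Definition sqnormA (A : 'M[R]_d) (x : 'cV[R]_d) : R := (x^T *m A *m x) ord0 ord0.
Definition in_ball (S : R) (th : 'cV[R]_d) : Prop := dotv th th <= S ^+ 2.

Definition glm_link (S L kappa : R) (mu m : R -> R) : Prop :=
  (forall a b, -S <= a <= S -> -S <= b <= S -> `|mu a - mu b| <= L * `|a - b|) /\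
  (forall z, -S < z < S -> derivable mu z (1 : R)) /\
  (forall z, -S < z < S -> {for z, continuous (derive1 mu)}) /\
  kappa = inf [set derive1 mu z | z in [set z : R | -S < z < S]] /\
  0 < kappa /\
  (forall z : R, is_derive z (1 : R) m (mu z)).

Definition lossf (m : R -> R) (z y : R) : R := - y * z + m z.
Definition dlossf (mu : R -> R) (z y : R) : R := - y + mu z.

Definition Amat (eps : R) (x : nat -> 'cV[R]_d) (t : nat) : 'M[R]_d :=
  eps%:M + \sum_(1 <= s < t.+1) (x s *m (x s)^T).

(* theta is a run of ONS-GLM(kappa, eps, S) on the data (x_t, y_t)_{t>=1}:
   theta_1 in the ball arbitrary, and theta_{t+1} is the A_t-projection
   (a minimiser over the ball of ||. - theta'_{t+1}||^2_{A_t}). *)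
Definition ons_run (mu : R -> R) (kappa eps S : R) (x : nat -> 'cV[R]_d)
    (y : nat -> R) (theta : nat -> 'cV[R]_d) : Prop :=
  in_ball S (theta 1%N) /\
  forall t, (1 <= t)%N ->
    let thp := theta t - (dlossf mu (dotv (x t) (theta t)) (y t) / kappa)
                          *: (invmx (Amat eps x t) *m x t) in
    in_ball S (theta t.+1) /\
    forall phi, in_ball S phi ->
      sqnormA (Amat eps x t) (theta t.+1 - thp) <= sqnormA (Amat eps x t) (phi - thp).

Definition ons_regret (m : R -> R) (x : nat -> 'cV[R]_d) (y : nat -> R)
    (theta : nat -> 'cV[R]_d) (thstar : 'cV[R]_d) (t : nat) : R :=
  \sum_(1 <= s < t.+1)
    (lossf m (dotv (x s) (theta s)) (y s) - lossf m (dotv (x s) thstar) (y s)).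

Definition B_ons (mu : R -> R) (kappa eps S : R) (x : nat -> 'cV[R]_d)
    (y : nat -> R) (theta : nat -> 'cV[R]_d) (t : nat) : R :=
  (2 * kappa)^-1 * \sum_(1 <= s < t.+1)
     ((dlossf mu (dotv (x s) (theta s)) (y s)) ^+ 2
        * sqnormA (invmx (Amat eps x s)) (x s))
  + 2 * kappa * S ^+ 2 * eps.

Definition glb_data (S : R) (mu : R -> R) (thstar : 'cV[R]_d)
    (x : nat -> 'cV[R]_d) (eta y : nat -> R) : Prop :=
  in_ball S thstar /\
  (forall t, (1 <= t)%N -> dotv (x t) (x t) <= 1) /\
  (forall t, (1 <= t)%N -> y t = mu (dotv (x t) thstar) + eta t).

End GLB.

Section Prob.
Local Open Scope ereal_scope.
Variables (dsp : measure_display) (T : measurableType dsp) (R : realType) (d : nat).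

(* sigma-algebra of the past before observing eta_t:
   generated by x_1,...,x_t and eta_1,...,eta_{t-1} *)
Definition past_sigma (X : nat -> T -> 'cV[R]_d) (eta : nat -> T -> R) (t : nat)
  : set (set T) :=
  <<s (\bigcup_(s in [set s : nat | (1 <= s <= t)%N])
         \bigcup_(i in [set: 'I_d])
           preimage_set_system setT (fun w => X s w i ord0) measurable)
      `|` (\bigcup_(s in [set s : nat | (1 <= s < t)%N])
           preimage_set_system setT (eta s) measurable) >>.

(* eta_t is conditionally Rs-sub-Gaussian given x_t and the past:
   E[exp(lam eta_t) | F_t] <= exp(lam^2 Rs^2 / 2) a.s., written out through
   the defining property of conditional expectation on the events of F_t. *)
Definition cond_subgaussian (P : probability T R) (X : nat -> T -> 'cV[R]_d)
    (eta : nat -> T -> R) (Rs : R) : Prop :=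
  forall t, (1 <= t)%N -> forall (lam : R) (A : set T), past_sigma X eta t A ->
    \int[P]_(w in A) (expR (lam * eta t w))%:E
      <= (expR (lam ^+ 2 * Rs ^+ 2 / 2))%:E * P A.

End Prob.

(* Main.v *)
Require Import Defs.
From HB Require Import structures.
From mathcomp Require Import all_boot all_order all_algebra.
From mathcomp Require Import all_classical all_reals all_analysis.
From mathcomp Require Import measurable_realfun ring lra.
Import Order.TTheory GRing.Theory Num.Theory.
Import numFieldNormedType.Exports.
Local Open Scope classical_set_scope.
Local Open Scope ring_scope.

(* Per round, the [kappa]-strong convexity of the loss and the contraction
   property of the [A_t]-projection bound the regret by the decrease of the
   potential [kappa / 2 * ||theta_t - theta*||^2_(A_(t-1))] plus
   [g_t^2 ||x_t||^2_(A_t^-1) / (2 kappa)]; summing over rounds gives the regret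
   bound.  Since [det A_(t-1) = det A_t (1 - ||x_t||^2_(A_t^-1))], the sum of the
   [||x_s||^2_(A_s^-1)] is at most [ln (det A_t / eps^d)], and
   [det A_t <= (eps + t)^d] by iterated Schur complements.  The link being
   [L]-Lipschitz, [g_s^2 <= 2 (4 S^2 L^2 + eta_s^2)], and the constant term
   [2 kappa S^2 eps] is absorbed because [kappa <= L].  For sub-Gaussian noise
   Chernoff tails at level [delta / (s (s + 1))] and a union bound over [s] give
   [eta_s^2 = O(R^2 log t)] for all [s <= t], simultaneously for all [t]. *)

(** * Quadratic forms, positive definite matrices and determinants *)

Section LinearAlgebra.
Set Implicit Arguments.
Unset Strict Implicit.
Variable R : realType.

(** Polar form of [sqnormA]: expanding squares through its bilinearity leaves inequalities between
    scalars that [lra] can close. *)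
Definition bilA d (A : 'M[R]_d) (u v : 'cV[R]_d) : R := (u^T *m A *m v) ord0 ord0.

Lemma bilADl d (A : 'M[R]_d) u v w : bilA A (u + v) w = bilA A u w + bilA A v w.
Proof. by rewrite /bilA linearD /= !mulmxDl mxE. Qed.

Lemma bilADr d (A : 'M[R]_d) u v w : bilA A w (u + v) = bilA A w u + bilA A w v.
Proof. by rewrite /bilA mulmxDr mxE. Qed.

Lemma bilAZl d (A : 'M[R]_d) c u w : bilA A (c *: u) w = c * bilA A u w.
Proof. by rewrite /bilA linearZ /= -!scalemxAl mxE. Qed.

Lemma bilAZr d (A : 'M[R]_d) c u w : bilA A w (c *: u) = c * bilA A w u.
Proof. by rewrite /bilA -!scalemxAr mxE. Qed.

Lemma bilANl d (A : 'M[R]_d) u w : bilA A (- u) w = - bilA A u w.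
Proof. by rewrite -scaleN1r bilAZl mulN1r. Qed.

Lemma bilANr d (A : 'M[R]_d) u w : bilA A w (- u) = - bilA A w u.
Proof. by rewrite -scaleN1r bilAZr mulN1r. Qed.

Lemma bilAC d (A : 'M[R]_d) u v : A^T = A -> bilA A u v = bilA A v u.
Proof.
move=> Asym; rewrite /bilA -[in LHS](trmxK (_ *m _ *m v)) mxE.
by rewrite !trmx_mul Asym trmxK mulmxA.
Qed.

Definition bilAE := (bilADl, bilADr, bilANl, bilANr, bilAZl, bilAZr).

Lemma sqnormAE d (A : 'M[R]_d) u : sqnormA A u = bilA A u u.
Proof. by []. Qed.

Lemma dotvE d (u v : 'cV[R]_d) : dotv u v = bilA 1%:M u v.
Proof. by rewrite /bilA mulmx1. Qed.

Lemma dotvC d (u v : 'cV[R]_d) : dotv u v = dotv v u.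
Proof. by rewrite !dotvE bilAC ?trmx1. Qed.

Lemma dotvv d (u : 'cV[R]_d) : dotv u u = \sum_i u i ord0 ^+ 2.
Proof. by rewrite /dotv mxE; apply: eq_bigr => i _; rewrite mxE -expr2. Qed.

Lemma dotvv_ge0 d (u : 'cV[R]_d) : 0 <= dotv u u.
Proof. by rewrite dotvv sumr_ge0 // => i _; rewrite sqr_ge0. Qed.

Lemma dotvv_gt0 d (u : 'cV[R]_d) : u != 0 -> 0 < dotv u u.
Proof.
move=> u0; rewrite lt_neqAle dotvv_ge0 andbT eq_sym.
apply: contraNneq u0; rewrite dotvv => /eqP.
rewrite psumr_eq0 => [/allP u0|i _]; last exact: sqr_ge0.
apply/eqP/colP => i; rewrite mxE.
by have := u0 i (mem_index_enum _); rewrite sqrf_eq0 => /eqP.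
Qed.

Lemma sqr_coord_le_dotvv d (u : 'cV[R]_d) i : u i ord0 ^+ 2 <= dotv u u.
Proof.
by rewrite dotvv (bigD1 i) //= lerDl sumr_ge0 // => j _; rewrite sqr_ge0.
Qed.

Lemma bilA_rank1 d (x u v : 'cV[R]_d) :
  bilA (x *m x^T) u v = dotv x u * dotv x v.
Proof.
by rewrite [dotv x u]dotvC /bilA /dotv mulmxA -mulmxA mxE big_ord1.
Qed.

Lemma bilA_addmx d (A B : 'M[R]_d) u v : bilA (A + B) u v = bilA A u v + bilA B u v.
Proof. by rewrite /bilA mulmxDr mulmxDl mxE. Qed.

Lemma bilA_scalar_mx d c (u v : 'cV[R]_d) : bilA c%:M u v = c * dotv u v.
Proof. by rewrite /bilA -scalemx1 -scalemxAr -scalemxAl mulmx1 mxE. Qed.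

Definition posdef d (A : 'M[R]_d) : Prop :=
  A^T = A /\ forall v : 'cV[R]_d, v != 0 -> 0 < sqnormA A v.

Lemma posdef_ge0 d (A : 'M[R]_d) v : posdef A -> 0 <= sqnormA A v.
Proof.
move=> [_ Apos]; have [->|/Apos/ltW //] := eqVneq v 0.
by rewrite /sqnormA mulmx0 mxE.
Qed.

(** Induction on the dimension: with corner [a] and Schur complement [C = D - a^-1 b b^T],
    [det A = a * det C]. [C] is positive definite, being the congruence [U^T A U], and its diagonal
    lies below that of [D], so the bound [M] is inherited. *)
Lemma posdef_det_bounds d (A : 'M[R]_d) M :
  posdef A -> (forall i, A i i <= M) -> 0 < \det A <= M ^+ d.
Proof.
elim: d A => [|d IH]; first by move=> A; rewrite det_mx00 expr0 ltr01 lexx.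
rewrite -[d.+1]/(1 + d)%N => A.
move=> [Asym Apos] AM.
pose a := A ord0 ord0; pose b := dlsubmx A; pose D := drsubmx A.
have AE : A = block_mx a%:M b^T b D.
  rewrite -[LHS]submxK; congr block_mx.
    rewrite [LHS]mx11_scalar; congr (_%:M).
    by rewrite !mxE; congr (A _ _); apply/val_inj.
  by rewrite /b trmx_dlsub Asym.
have a_gt0 : 0 < a.
  have := Apos (delta_mx ord0 ord0).
  rewrite /sqnormA trmx_delta -rowE -colE !mxE; apply.
  apply/eqP => /matrixP/(_ ord0 ord0); rewrite !mxE !eqxx => /eqP.
  by rewrite oner_eq0.
pose U := col_mx (- (a^-1 *: b^T)) 1%:M : 'M[R]_(1 + d, d).
pose C := D - a^-1 *: (b *m b^T).
have AU : A *m U = col_mx 0 C.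
  rewrite AE /U mul_block_col; congr col_mx.
    by rewrite mulmx1 mul_scalar_mx scalerN scalerA divff ?gt_eqF // scale1r addNr.
  by rewrite mulmx1 mulmxN -scalemxAr addrC.
have UAU : U^T *m A *m U = C.
  rewrite -mulmxA AU /U tr_col_mx mul_row_col mulmx0 add0r trmx1 mul1mx //.
have Csym : C^T = C.
  by rewrite -UAU !trmx_mul trmxK Asym mulmxA.
have detA : \det A = a * \det C.
  have := congr1 determinant (_ : A *m block_mx 1%:M (- (a^-1 *: b^T)) 0 1%:M
                                  = block_mx a%:M 0 b C).
  rewrite det_mulmx det_ublock det_lblock !det1 !mulr1 det_scalar1; apply.
  rewrite !block_mxEh mul_mx_row AU; congr row_mx.
  by rewrite AE mul_block_col !mulmx0 !mulmx1 !addr0.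
have Cpos : posdef C.
  split=> // w w0; rewrite /sqnormA -UAU.
  have -> : w^T *m (U^T *m A *m U) *m w = (U *m w)^T *m A *m (U *m w).
    by rewrite trmx_mul !mulmxA.
  apply: Apos; apply: contra_neq w0 => /(congr1 dsubmx).
  by rewrite /U mul_col_mx col_mxKd mul1mx linear0.
have /andP[C0 CM] : 0 < \det C <= M ^+ d.
  apply: IH => // i.
  have DM : D i i <= M by rewrite /D !mxE; exact: AM.
  have -> : C i i = D i i - a^-1 * b i ord0 ^+ 2.
    rewrite /C; move: b D {DM AE U AU UAU C Csym detA Cpos} => b D.
    by rewrite !mxE big_ord1 mxE expr2.
  apply: le_trans DM; rewrite gerBl.
  by rewrite mulr_ge0 ?invr_ge0 ?(ltW a_gt0) ?sqr_ge0.
rewrite detA mulr_gt0 //= exprS ler_pM ?(ltW a_gt0) ?(ltW C0) //.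
exact: AM.
Qed.

Lemma posdef_unitmx d (A : 'M[R]_d) : posdef A -> A \in unitmx.
Proof.
move=> Apos; rewrite unitmxE unitfE gt_eqF //.
(* Any common bound on the diagonal gives access to the positivity half of [posdef_det_bounds]. *)
have diag_le i : A i i <= \sum_j `|A j j|.
  by rewrite (bigD1 i) //= (le_trans (ler_norm _)) // lerDl sumr_ge0.
by have /andP[] := posdef_det_bounds Apos diag_le.
Qed.

(** Both sides are the determinant of the bordered matrix [[A, x; x^T, 1]], reduced by clearing
    either [x^T] or [x]. *)
Lemma det_rank1_downdate d (A : 'M[R]_d) (x : 'cV[R]_d) : A \in unitmx ->
  \det (A - x *m x^T) = \det A * (1 - sqnormA (invmx A) x).
Proof.
move=> Au; pose B := block_mx A x x^T 1%:M : 'M[R]_(d + 1).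
transitivity (\det B).
  have := det_mulmx B (block_mx 1%:M 0 (- x^T) 1%:M).
  rewrite /B mulmx_block det_lblock !det1 !mulr1 => <-.
  rewrite !mulmx1 !mulmx0 !mul1mx addrN !add0r det_ublock det1 mulr1.
  by rewrite mulmxN.
have := det_mulmx B (block_mx 1%:M (- (invmx A *m x)) 0 1%:M).
rewrite /B mulmx_block det_ublock !det1 !mulr1 => <-.
rewrite !mulmx1 !mulmx0 !mulmxN !addr0 mulKVmx // addNr det_lblock.
congr (_ * _); rewrite mulmxA [X in \det X]mx11_scalar det_scalar1 /sqnormA.
by rewrite mxE [X in X + _]mxE [X in _ + X]mxE addrC.
Qed.

End LinearAlgebra.

(** * Strong convexity of the integrated link *)

Section Link.
Set Implicit Arguments.
Unset Strict Implicit.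
Variable R : realType.

(** The mean value theorem needs continuity up to the endpoints, where the link is only known to be
    Lipschitz. *)
Lemma lipschitz_within_continuous (f : R -> R) (L a b : R) :
  (forall u v, a <= u <= b -> a <= v <= b -> `|f u - f v| <= L * `|u - v|) ->
  {within `[a, b], continuous f}.
Proof.
move=> fL; apply/subspace_continuousP => u; rewrite /= in_itv /= => uab.
apply/cvgrPdist_lt => e e0; rewrite near_withinE.
(* The sign of [L] is unknown here; [|L| + 1] is a positive Lipschitz constant. *)
have L0 : 0 < `|L| + 1 by rewrite ltr_wpDl.
have eL : 0 < e / (`|L| + 1) by rewrite divr_gt0.
near=> v; rewrite /= in_itv /= => vab.
apply: le_lt_trans (fL _ _ uab vab) _.
apply: (@le_lt_trans _ _ ((`|L| + 1) * `|u - v|)).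
  by rewrite ler_wpM2r // (le_trans (ler_norm L)) // lerDl.
rewrite mulrC -ltr_pdivlMr //.
Unshelve. all: end_near. Qed.

Variables (S L kappa : R) (mu m : R -> R).
Hypotheses (S0 : 0 < S) (link : glm_link S L kappa mu m).

Lemma glm_kappa_gt0 : 0 < kappa.
Proof. by have [_ [_ [_ [_ []]]]] := link. Qed.

Lemma glm_kappa_le_derive1 (z : R) : - S < z < S -> kappa <= derive1 mu z.
Proof.
have [_ [_ [_ [kE _]]]] := link; move=> zS; rewrite kE.
have [hinf|/inf_out i0] := pselect (has_inf [set derive1 mu z | z in [set z : R | - S < z < S]]).
  by apply: ge_inf; [exact: hinf.2|exists z].
(* Without an infimum, [inf] takes the default value 0, which contradicts [0 < kappa]. *)
by have := glm_kappa_gt0; rewrite kE i0 ltxx.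
Qed.

Lemma glm_strongly_monotone (a b : R) : - S <= a -> a <= b -> b <= S ->
  kappa * (b - a) <= mu b - mu a.
Proof.
have [Lip [dmu _]] := link.
move=> Sa; rewrite le_eqVlt => /predU1P[<-|ab] bS; first by rewrite !subrr mulr0.
have dmu_ab c : c \in `]a, b[ -> is_derive c 1 mu (derive1 mu c).
  rewrite in_itv /= => /andP[ac cb]; rewrite derive1E.
  by apply/derivableP/dmu; rewrite (le_lt_trans Sa ac) (lt_le_trans cb bS).
have mu_cont : {within `[a, b], continuous mu}.
  apply: (@lipschitz_within_continuous _ L) => u v /andP[au ub] /andP[av vb].
  by apply: Lip; apply/andP; split; lra.
have [c cab ->] := MVT ab dmu_ab mu_cont.
rewrite ler_wpM2r ?subr_ge0 ?(ltW ab) // glm_kappa_le_derive1 //.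
by move: cab; rewrite in_itv /= => /andP[ac cb]; apply/andP; split; lra.
Qed.

(** Strong monotonicity and the Lipschitz bound are compared at the points 0 and [S]. *)
Lemma glm_kappa_le_L : kappa <= L.
Proof.
have [Lip _] := link.
have [S0l S0r] : - S <= 0 <= S /\ - S <= S <= S.
  by rewrite !lexx; split; apply/andP; split=> //; have := S0; lra.
have := glm_strongly_monotone (a := 0) (b := S).
have := S0; move=> S0' /(_ ltac:(lra) ltac:(lra) ltac:(lra)) h.
have := Lip _ _ S0r S0l; rewrite subr0 (gtr0_norm S0) => h'.
have := le_trans (ler_norm _) h' => h2.
rewrite -(ler_pM2r S0); lra.
Qed.

Lemma glm_strongly_convex (a b : R) : - S <= a <= S -> - S <= b <= S ->
  m a + mu a * (b - a) + kappa / 2 * (b - a) ^+ 2 <= m b.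
Proof.
have [_ [_ [_ [_ [_ dm]]]]] := link.
move=> /andP[Sa aS] /andP[Sb bS].
(* Once the quadratic is removed, the derivative [df] is still nondecreasing on the interval, so the
   claim becomes the tangent-line inequality for the convex [f]. *)
pose f : R -> R := m - (kappa / 2) \*: (id ^+ 2).
pose df z := mu z - kappa * z.
have fd (z : R) : is_derive z 1 f (df z).
  rewrite /f /df; have -> : kappa * z = (kappa / 2) *: ((2%:R * z ^+ 1) *: 1).
    by rewrite /GRing.scale /= mulr1 expr1 mulrA divfK.
  apply: is_deriveB.
have fE z : f z = m z - kappa / 2 * z ^+ 2 by [].
have fcont (i : interval R) : {within [set` i], continuous f}.
  by apply: derivable_within_continuous => z _; exact: ex_derive.
suff : df a * (b - a) <= f b - f a by rewrite !fE /df; lra.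
have [ab|ba|->] := ltgtP a b; last by rewrite !subrr mulr0.
- have [c cab ->] := MVT ab (fun c _ => fd c) (fcont _).
  move: cab; rewrite in_itv /= => /andP[ac cb].
  rewrite ler_wpM2r ?subr_ge0 ?(ltW ab) // /df.
  have := glm_strongly_monotone Sa (ltW ac) (le_trans (ltW cb) bS); lra.
- have [c cab] := MVT ba (fun c _ => fd c) (fcont _).
  move: cab; rewrite in_itv /= => /andP[bc ca].
  have := glm_strongly_monotone (le_trans Sb (ltW bc)) (ltW ca) aS.
  rewrite /df => h1 h2.
  have : 0 <= (a - b) * (mu a - mu c - kappa * (a - c)).
    by rewrite mulr_ge0 // ?subr_ge0 // ltW.
  lra.
Qed.

End Link.

(** * Projection onto the ball and the ONS regret bound *)

Section Regret.
Set Implicit Arguments.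
Unset Strict Implicit.
Variables (R : realType) (d : nat).
Implicit Types (p q z u v : 'cV[R]_d) (A : 'M[R]_d).

(** Cauchy-Schwarz without square roots, from the nonnegative squared norms of [S u + v] and
    [S u - v]. *)
Lemma dotv_le_radius (S : R) u v : 0 < S -> dotv u u <= 1 -> in_ball S v ->
  - S <= dotv u v <= S.
Proof.
rewrite /in_ball => S0 u1 vS.
have vu : dotv v u = dotv u v by rewrite dotvC.
have hp := dotvv_ge0 (S *: u + v); have hn := dotvv_ge0 (S *: u - v).
move: vS u1 vu hp hn; rewrite !dotvE !bilAE -!dotvE => vS u1 vu hp hn.
have SSu : S * (S * dotv u u) <= S * S.
  by rewrite ler_pM2l // -[leRHS]mulr1 ler_pM2l.
rewrite vu in hp hn.
apply/andP; split; rewrite -(ler_pM2l S0); lra.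
Qed.

(** The squared norm at the point equals [(1-t)|p|^2 + t|q|^2 - t(1-t)|q-p|^2]. *)
Lemma in_ball_segment (S t : R) p q : 0 <= t <= 1 -> in_ball S p -> in_ball S q ->
  in_ball S (p + t *: (q - p)).
Proof.
rewrite /in_ball => /andP[t0 t1] pS qS.
have qp : dotv q p = dotv p q by rewrite dotvC.
have h := dotvv_ge0 (q - p).
have h2 : 0 <= t * (1 - t) * dotv (q - p) (q - p) by rewrite !mulr_ge0 // subr_ge0.
have hpS : 0 <= (1 - t) * (S ^+ 2 - dotv p p) by rewrite mulr_ge0 // subr_ge0.
have hqS : 0 <= t * (S ^+ 2 - dotv q q) by rewrite mulr_ge0 // subr_ge0.
move: h2 qp hpS hqS; rewrite !dotvE !bilAE -!dotvE => h2 qp hpS hqS.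
by rewrite qp in h2 *; lra.
Qed.

Lemma sqdist_ball_le (S : R) p q : in_ball S p -> in_ball S q ->
  dotv (p - q) (p - q) <= 4 * S ^+ 2.
Proof.
rewrite /in_ball => pS qS; have := dotvv_ge0 (p + q).
have qp : dotv q p = dotv p q by rewrite dotvC.
move: qp; rewrite !dotvE !bilAE -!dotvE => ->; lra.
Qed.

(* First-order optimality along the segment from [p] to [q] makes the angle at
   [p] obtuse, so replacing [z] by [p] brings it closer to [q]. *)
Lemma ball_projection_contract (S : R) A p q z : posdef A ->
  in_ball S p -> in_ball S q ->
  (forall phi, in_ball S phi -> sqnormA A (p - z) <= sqnormA A (phi - z)) ->
  sqnormA A (p - q) <= sqnormA A (z - q).
Proof.
move=> Apos pS qS pmin.
move uE : (p - z) pmin => u pmin; move vE : (q - p) => v.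
have vu : bilA A v u = bilA A u v by rewrite bilAC //; case: Apos.
have -> : p - q = - v by rewrite -vE opprB.
have -> : z - q = - (u + v) by rewrite -uE -vE; apply/colP => i; rewrite !mxE; ring.
have v0 := posdef_ge0 v Apos; have u0 := posdef_ge0 u Apos.
suff uv0 : 0 <= bilA A u v.
  by move: v0 u0; rewrite !sqnormAE !bilAE vu; lra.
rewrite leNgt; apply/negP => uv_lt0.
pose c := - (2 * bilA A u v); pose n := sqnormA A v.
have c0 : 0 < c by rewrite /c; lra.
have s0 : 0 < c + n + 1 by rewrite /n; lra.
(* Minimality at step [t] forces [c <= t n], whereas this choice gives [c = t c + t n + t > t n]; it
   also stays below 1, hence on the segment. *)
pose t := c / (c + n + 1).
have t0 : 0 < t by rewrite divr_gt0.
have t1 : t <= 1 by rewrite ler_pdivrMr // mul1r /n; lra.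
have /pmin : in_ball S (p + t *: v).
  by rewrite -vE; apply: in_ball_segment => //; rewrite (ltW t0) t1.
have -> : p + t *: v - z = u + t *: v.
  by rewrite -uE -vE; apply/colP => i; rewrite !mxE; ring.
rewrite !sqnormAE !bilAE vu => h.
have ct : c <= t * n.
  by rewrite -(ler_pM2l t0) /n /c sqnormAE; lra.
have : t * (c + n + 1) = c by rewrite /t divfK // gt_eqF.
have : 0 < t * c by rewrite mulr_gt0.
lra.
Qed.

Variables (eps : R) (x : nat -> 'cV[R]_d).
Hypothesis eps0 : 0 < eps.

Lemma Amat0 : Amat eps x 0 = eps%:M.
Proof. by rewrite /Amat big_geq // addr0. Qed.

Lemma AmatS t : Amat eps x t.+1 = Amat eps x t + x t.+1 *m (x t.+1)^T.
Proof. by rewrite /Amat big_nat_recr //= addrA. Qed.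

Lemma Amat_posdef t : posdef (Amat eps x t).
Proof.
elim: t => [|t [sym pos]].
  rewrite Amat0; split=> [|v v0]; first by rewrite tr_scalar_mx.
  by rewrite sqnormAE bilA_scalar_mx mulr_gt0 // dotvv_gt0.
rewrite AmatS; split=> [|v v0]; first by rewrite linearD /= trmx_mul trmxK sym.
by rewrite sqnormAE bilA_addmx bilA_rank1 ltr_wpDr ?pos // -expr2 sqr_ge0.
Qed.

Lemma sqnormA_AmatS t v :
  sqnormA (Amat eps x t.+1) v = sqnormA (Amat eps x t) v + dotv (x t.+1) v ^+ 2.
Proof. by rewrite AmatS !sqnormAE bilA_addmx bilA_rank1 expr2. Qed.

Variables (S L kappa : R) (mu m : R -> R).
Variables (y : nat -> R) (theta : nat -> 'cV[R]_d) (thstar : 'cV[R]_d).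
Hypotheses (S0 : 0 < S) (link : glm_link S L kappa mu m).
Hypotheses (thstarS : in_ball S thstar).
Hypotheses (x1 : forall t, (1 <= t)%N -> dotv (x t) (x t) <= 1).
Hypothesis (run : ons_run mu kappa eps S x y theta).

Lemma ons_in_ball t : (1 <= t)%N -> in_ball S (theta t).
Proof. by case: run => th1 thS; case: t => [|[|t]] // _; have [] := thS t.+1. Qed.

(** The projection contracts towards [thstar], and in the expanded square of the unprojected iterate
    [A w = x t] turns the cross term into the linearised loss. *)
Lemma ons_step t g : (1 <= t)%N -> g = dlossf mu (dotv (x t) (theta t)) (y t) ->
  kappa / 2 * sqnormA (Amat eps x t) (theta t.+1 - thstar)
    + g * dotv (x t) (theta t - thstar)
  <= kappa / 2 * sqnormA (Amat eps x t) (theta t - thstar)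
    + (2 * kappa)^-1 * (g ^+ 2 * sqnormA (invmx (Amat eps x t)) (x t)).
Proof.
move=> t1 gE; have k0 := glm_kappa_gt0 link.
have [thS thmin] := run.2 _ t1; rewrite /= -gE in thmin.
have Apos := Amat_posdef t; set A := Amat eps x t in thmin Apos *.
have := ball_projection_contract Apos thS thstarS thmin.
move hE : (theta t - thstar) => h; move: (theta t.+1 - _) => h'; set w := invmx A *m x t.
have -> : theta t - (g / kappa) *: w - thstar = h - (g / kappa) *: w.
  by rewrite -hE addrAC.
have Asym : A^T = A by case: Apos.
have Aw : A *m w = x t by rewrite mulKVmx // posdef_unitmx.
have hw : bilA A h w = dotv (x t) h by rewrite /bilA -mulmxA Aw dotvC.
have wh : bilA A w h = dotv (x t) h by rewrite bilAC.
have ww : bilA A w w = sqnormA (invmx A) (x t).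
  by rewrite /bilA -mulmxA Aw -/(dotv _ _) dotvC /dotv /sqnormA -mulmxA.
rewrite !sqnormAE !bilAE hw wh ww -!sqnormAE.
set a := sqnormA A h'; set b := sqnormA A h.
set c := dotv _ _; set e := sqnormA _ _ => le1.
have k20 : 0 < kappa / 2 by rewrite divr_gt0.
have := le1; rewrite -(ler_pM2l k20).
have -> : kappa / 2 * (b + - (g / kappa * c) + (- (g / kappa * c) + - (g / kappa * - (g / kappa * e))))
  = kappa / 2 * b - g * c + (2 * kappa)^-1 * (g ^+ 2 * e).
  by field; rewrite gt_eqF.
lra.
Qed.

(* [kappa / 2 * ||theta_(t+1) - thstar||^2_(A_t)] is the telescoping potential;
   the rank-one growth of [A_t] is paid for by the strong convexity of the loss. *)
Lemma ons_regret_potential t :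
  ons_regret m x y theta thstar t
    + kappa / 2 * sqnormA (Amat eps x t) (theta t.+1 - thstar)
  <= B_ons mu kappa eps S x y theta t.
Proof.
have k0 := glm_kappa_gt0 link.
elim: t => [|t IH].
  (* The initial potential is [kappa / 2 * eps * |theta_1 - thstar|^2]; the diameter [2 S] of the
     ball gives the constant term of [B_ons]. *)
  rewrite /ons_regret /B_ons !big_geq // mulr0 !add0r Amat0 sqnormAE bilA_scalar_mx.
  have := sqdist_ball_le (ons_in_ball (leqnn 1)) thstarS.
  rewrite -(ler_pM2l (mulr_gt0 k0 eps0)); lra.
have step := ons_step (ltn0Sn t) erefl.
move: IH; rewrite /ons_regret /B_ons !(@big_nat_recr _ _ _ t.+1) //= => IH.
move: step; rewrite [sqnormA (Amat eps x t.+1) (theta t.+1 - _)]sqnormA_AmatS /=.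
have thS := ons_in_ball (ltn0Sn t).
have aS := dotv_le_radius S0 (x1 (ltn0Sn t)) thS.
have bS := dotv_le_radius S0 (x1 (ltn0Sn t)) thstarS.
have := glm_strongly_convex link aS bS.
have -> : dotv (x t.+1) (theta t.+1 - thstar)
    = dotv (x t.+1) (theta t.+1) - dotv (x t.+1) thstar.
  by rewrite !dotvE !bilAE.
rewrite /lossf /dlossf => conv step; lra.
Qed.

Lemma ons_regret_le t :
  ons_regret m x y theta thstar t <= B_ons mu kappa eps S x y theta t.
Proof.
apply: le_trans (ons_regret_potential t).
by rewrite lerDl mulr_ge0 ?divr_ge0 ?(ltW (glm_kappa_gt0 link)) ?posdef_ge0 //;
  exact: Amat_posdef.
Qed.

End Regret.

(** * Elliptical potential and the deterministic bound on [B_ons] *)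

Section Potential.
Set Implicit Arguments.
Unset Strict Implicit.
Variable R : realType.

(** Transfers nonnegativity from the form of [A] to that of its inverse. *)
Lemma sqnormA_invmx d (A : 'M[R]_d) x : posdef A ->
  sqnormA (invmx A) x = sqnormA A (invmx A *m x).
Proof.
move=> Apos; rewrite [RHS]/sqnormA -mulmxA mulKVmx ?posdef_unitmx //.
by rewrite -/(dotv _ _) dotvC /dotv /sqnormA mulmxA.
Qed.

Lemma ln_le_subr1 (r : R) : 0 < r -> ln r <= r - 1.
Proof.
move=> r0; have -> : ln r = ln (1 + (r - 1)) by rewrite addrC subrK.
by apply: le_ln1Dx; lra.
Qed.

Variables (d : nat) (eps : R) (x : nat -> 'cV[R]_d).
Hypothesis eps0 : 0 < eps.
Hypotheses (x1 : forall t, (1 <= t)%N -> dotv (x t) (x t) <= 1).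

Lemma Amat_diag_le t i : Amat eps x t i i <= eps + t%:R.
Proof.
elim: t => [|t IH]; first by rewrite Amat0 mxE eqxx addr0.
rewrite AmatS mxE -[t.+1]addn1 natrD addrA lerD //.
apply: le_trans (x1 (ltn0Sn t)).
by rewrite mxE big_ord1 mxE -expr2 addn1 sqr_coord_le_dotvv.
Qed.

Lemma Amat_det_bounds t : 0 < \det (Amat eps x t) <= (eps + t%:R) ^+ d.
Proof. by apply: posdef_det_bounds; [exact: Amat_posdef|exact: Amat_diag_le]. Qed.

Lemma sum_sqnormA_invmx_le_ln_det t :
  \sum_(1 <= s < t.+1) sqnormA (invmx (Amat eps x s)) (x s)
    <= ln (\det (Amat eps x t)) - ln (eps ^+ d).
Proof.
elim: t => [|t IH]; first by rewrite big_geq // Amat0 det_scalar subrr.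
rewrite big_nat_recr //=.
have /andP[d0 _] := Amat_det_bounds t; have /andP[d1 _] := Amat_det_bounds t.+1.
set e := sqnormA _ _.
have detE : \det (Amat eps x t) = \det (Amat eps x t.+1) * (1 - e).
  by rewrite -det_rank1_downdate ?AmatS ?addrK // -AmatS posdef_unitmx //; exact: Amat_posdef.
(* Both determinants are positive, so [e < 1] and [e <= - ln (1 - e)], which is the increment of
   [ln det]. *)
have e0 : 0 < 1 - e by rewrite -(pmulr_rgt0 _ d1) -detE.
have := ln_le_subr1 e0.
move: IH; rewrite detE lnM ?posrE //; lra.
Qed.

Lemma elliptical_potential t :
  \sum_(1 <= s < t.+1) sqnormA (invmx (Amat eps x s)) (x s)
    <= d%:R * ln (1 + t%:R / eps).
Proof.
apply: le_trans (sum_sqnormA_invmx_le_ln_det t) _.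
have /andP[d0 d1] := Amat_det_bounds t.
have et0 : 0 < eps + t%:R by rewrite ltr_pwDl.
have lnd : ln (\det (Amat eps x t)) <= ln (eps + t%:R) *+ d.
  by rewrite -lnXn // ler_ln ?posrE ?exprn_gt0.
have -> : 1 + t%:R / eps = (eps + t%:R) / eps by rewrite mulrDl divff ?gt_eqF.
rewrite ln_div ?posrE // lnXn // mulrBr !mulr_natl; lra.
Qed.

(** Since [1 + t / eps <= t (1 + 1 / eps)], only an additive constant remains; [ln 2 <= ln t] makes
    it a multiple of [ln t]. *)
Lemma ln_one_plus_le t : (2 <= t)%N ->
  ln (1 + t%:R / eps) <= (1 + ln (1 + eps^-1) / ln 2) * ln t%:R.
Proof.
move=> t2; have t2R : 2 <= t%:R :> R by rewrite ler_nat.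
have i0 : 0 < eps^-1 by rewrite invr_gt0.
have ln2 : 0 < ln 2 :> R by apply: ln_gt0; lra.
have ln2t : ln 2 <= ln t%:R :> R by rewrite ler_ln ?posrE //; lra.
have lne : 0 <= ln (1 + eps^-1) by apply: ln_ge0; lra.
apply: (@le_trans _ _ (ln (t%:R * (1 + eps^-1)))).
  rewrite ler_ln ?posrE ?mulrDr ?mulr1 ?lerD2r; first lra.
  - by rewrite addr_gt0 // divr_gt0 //; lra.
  - by rewrite addr_gt0 // ?divr_gt0 //; lra.
rewrite lnM ?posrE; [|lra|lra].
rewrite mulrDl mul1r lerD2l mulrAC ler_pdivlMr // ler_wpM2l //.
Qed.

Variables (S L kappa : R) (mu m : R -> R).
Variables (eta y : nat -> R) (theta : nat -> 'cV[R]_d) (thstar : 'cV[R]_d).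
Hypotheses (S0 : 0 < S) (link : glm_link S L kappa mu m).
Hypothesis data : glb_data S mu thstar x eta y.
Hypothesis run : ons_run mu kappa eps S x y theta.

Lemma dlossf_sqr_le H s : (1 <= s)%N -> eta s ^+ 2 <= H ->
  dlossf mu (dotv (x s) (theta s)) (y s) ^+ 2 <= 2 * (4 * S ^+ 2 * L ^+ 2 + H).
Proof.
move=> s1 etaH; have [thS [_ ->]] := data => //; have [Lip _] := link.
have := dotv_le_radius S0 (x1 s1) thS; have := dotv_le_radius S0 (x1 s1) (ons_in_ball run s1).
rewrite /dlossf; set a := dotv _ (theta s); set b := dotv _ thstar => aS bS.
have L0 : 0 < L := lt_le_trans (glm_kappa_gt0 link) (glm_kappa_le_L S0 link).
have ab : `|mu a - mu b| <= L * (2 * S).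
  apply: le_trans (Lip _ _ aS bS) _; rewrite ler_pM2l // ler_norml.
  by move/andP: aS => [? ?]; move/andP: bS => [? ?]; apply/andP; split; lra.
have ab2 : (mu a - mu b) ^+ 2 <= (L * (2 * S)) ^+ 2.
  rewrite -[(mu a - mu b) ^+ 2]real_normK ?num_real // ler_sqr // ?nnegrE //.
  by rewrite mulr_ge0 ?mulr_ge0 ?(ltW L0) ?(ltW S0).
(* The gradient is [p - q] with [p = mu a - mu b] and [q = eta s], and [(p - q)^2 <= 2 p^2 + 2 q^2]
   amounts to [0 <= (p + q)^2]. *)
have := sqr_ge0 (mu a - mu b + eta s); lra.
Qed.

(** [H] is any common bound on the squared noise up to round [t], so it serves both noise models.
    The prefactor involves [S] and [eps] only: its first summand pays for the gradient sum, its
    second for [2 kappa S^2 eps]. *)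
Lemma B_ons_le H t : (1 <= d)%N -> (2 <= t)%N ->
  (forall s, (1 <= s <= t)%N -> eta s ^+ 2 <= H) ->
  B_ons mu kappa eps S x y theta t
  <= ((4 * S ^+ 2 + 1) * (1 + ln (1 + eps^-1) / ln 2) + 2 * S ^+ 2 * eps / ln 2)
     * ((L ^+ 2 + H) / kappa * d%:R * ln t%:R).
Proof.
move=> d1 t2 etaH; have k0 := glm_kappa_gt0 link.
have kL := glm_kappa_le_L S0 link.
have H0 : 0 <= H by apply: le_trans (etaH 1%N _); rewrite ?sqr_ge0 ?(ltnW t2).
have ln2 : 0 < ln 2 :> R by apply: ln_gt0; lra.
have lnt : ln 2 <= ln t%:R :> R.
  by rewrite ler_ln ?posrE ?ler_nat // ltr0n (ltnW t2).
have dR : 1 <= d%:R :> R by rewrite ler1n.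
rewrite /B_ons [leRHS]mulrDl; apply: lerD.
  set G := 4 * S ^+ 2 * L ^+ 2 + H.
  have G0 : 0 <= G.
    have : 0 <= S ^+ 2 * L ^+ 2 by rewrite mulr_ge0 ?sqr_ge0.
    by rewrite /G; lra.
  have sum1 : \sum_(1 <= s < t.+1) ((dlossf mu (dotv (x s) (theta s)) (y s)) ^+ 2
                * sqnormA (invmx (Amat eps x s)) (x s))
      <= 2 * G * (d%:R * ((1 + ln (1 + eps^-1) / ln 2) * ln t%:R)).
    apply: (@le_trans _ _ (\sum_(1 <= s < t.+1)
                (2 * G * sqnormA (invmx (Amat eps x s)) (x s)))).
      rewrite big_nat_cond [leRHS]big_nat_cond; apply: ler_sum => s.
      rewrite andbT ltnS => /andP[s1 st].
      rewrite ler_wpM2r //; last by rewrite dlossf_sqr_le // etaH // s1.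
      have Apos := Amat_posdef x eps0 s.
      by rewrite sqnormA_invmx // posdef_ge0.
    rewrite -mulr_sumr ler_wpM2l ?mulr_ge0 //.
    apply: le_trans (elliptical_potential t) _.
    by rewrite ler_wpM2l // ln_one_plus_le.
  set K := 1 + _ in sum1 *.
  have K0 : 0 <= K by rewrite addr_ge0 // divr_ge0 ?(ltW ln2) // ln_ge0 // lerDl invr_ge0 ltW.
  have GL : G <= (4 * S ^+ 2 + 1) * (L ^+ 2 + H).
    have : 0 <= S ^+ 2 * H by rewrite mulr_ge0 ?sqr_ge0.
    have := sqr_ge0 L; rewrite /G; lra.
  apply: (@le_trans _ _ ((2 * kappa)^-1 * (2 * G * (d%:R * (K * ln t%:R))))).
    by rewrite ler_wpM2l // invr_ge0 mulr_ge0 // ltW.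
  have -> : (2 * kappa)^-1 * (2 * G * (d%:R * (K * ln t%:R)))
      = G * (K / kappa * d%:R * ln t%:R) by field; rewrite gt_eqF.
  have -> : (4 * S ^+ 2 + 1) * K * ((L ^+ 2 + H) / kappa * d%:R * ln t%:R)
     = (4 * S ^+ 2 + 1) * (L ^+ 2 + H) * (K / kappa * d%:R * ln t%:R) by ring.
  rewrite ler_wpM2r // !mulr_ge0 ?invr_ge0 ?(ltW k0) //.
  by rewrite (le_trans _ lnt) // ltW.
have -> : 2 * S ^+ 2 * eps / ln 2 * ((L ^+ 2 + H) / kappa * d%:R * ln t%:R)
   = 2 * S ^+ 2 * eps * ((L ^+ 2 + H) / kappa * (d%:R * (ln t%:R / ln 2))).
  by field; rewrite !gt_eqF.
(* The factors are compared one by one: [kappa <= (L^2 + H) / kappa], [1 <= d] and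
   [1 <= ln t / ln 2]. *)
rewrite [leLHS](_ : _ = 2 * S ^+ 2 * eps * (kappa * (1 * 1))); last by ring.
have L2 : kappa <= (L ^+ 2 + H) / kappa.
  rewrite ler_pdivlMr // -expr2.
  have : kappa ^+ 2 <= L ^+ 2 by rewrite ler_sqr ?nnegrE ?(ltW k0) // (le_trans (ltW k0)).
  lra.
have c0 : 0 <= 2 * S ^+ 2 * eps.
  have : 0 <= S ^+ 2 * eps by rewrite mulr_ge0 ?sqr_ge0 ?(ltW eps0).
  lra.
apply: ler_wpM2l => //; apply: ler_pM; rewrite ?mulr1 ?(ltW k0) //.
by rewrite -[leLHS]mulr1 ler_pM // ler_pdivlMr // mul1r.
Qed.

End Potential.

(** * Sub-Gaussian tails, uniformly over rounds *)

Section Tail.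
Set Implicit Arguments.
Unset Strict Implicit.
Variables (dsp : measure_display) (T : measurableType dsp) (R : realType).
Variable P : probability T R.

Local Open Scope ereal_scope.

Lemma subgaussian_upper_tail (X : T -> R) (r u : R) :
  measurable_fun setT X -> (0 < r)%R -> (0 < u)%R ->
  (forall lam : R, \int[P]_w (expR (lam * X w))%:E
                     <= (expR (lam ^+ 2 * r ^+ 2 / 2))%:E) ->
  P [set w | (u <= X w)%R] <= (expR (- (u ^+ 2 / (2 * r ^+ 2))))%:E.
Proof.
move=> mX r0 u0 mgf.
(* [u / r^2] minimises the Chernoff exponent [lam^2 r^2 / 2 - lam u]. *)
have l0 : (0 < u / r ^+ 2)%R by rewrite divr_gt0 ?exprn_gt0.
have := @chernoff _ _ _ P (mfun_Sub (mem_set mX)) _ u l0.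
move=> /le_trans; apply.
have -> : 'M_P (mfun_Sub (mem_set mX)) (u / r ^+ 2)
    = \int[P]_w (expR (u / r ^+ 2 * X w))%:E.
  rewrite /mmt_gen_fun unlock; apply: eq_integral => w _ /=.
  by rewrite mulrC.
apply: (@le_trans _ _ ((expR ((u / r ^+ 2) ^+ 2 * r ^+ 2 / 2))%:E
                        * (expR (- (u / r ^+ 2 * u)))%:E)).
  by rewrite lee_wpmul2r // lee_fin expR_ge0.
rewrite -EFinM -expRD lee_fin ler_expR.
suff -> : ((u / r ^+ 2) ^+ 2 * r ^+ 2 / 2 - u / r ^+ 2 * u
   = - (u ^+ 2 / (2 * r ^+ 2)))%R by [].
by field; rewrite gt_eqF.
Qed.

Lemma measurable_ge (X : T -> R) (u : R) : measurable_fun setT X ->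
  measurable [set w | (u <= X w)%R].
Proof.
move=> mX; rewrite -[X in measurable X]setTI.
have -> : [set w | (u <= X w)%R] = X @^-1` `[u, +oo[.
  by apply/seteqP; split => w /=; rewrite in_itv /= andbT.
exact: mX.
Qed.

Lemma abs_ge_setE (X : T -> R) (u : R) :
  [set w | (u <= `|X w|)%R] = [set w | (u <= X w)%R] `|` [set w | (u <= - X w)%R].
Proof. by apply/seteqP; split => w /=; rewrite ler_normr => /orP. Qed.

Lemma measurable_abs_ge (X : T -> R) (u : R) : measurable_fun setT X ->
  measurable [set w | (u <= `|X w|)%R].
Proof.
move=> mX; rewrite abs_ge_setE; apply: measurableU; apply: measurable_ge => //.
exact: measurable_funN.
Qed.

(** The moment hypothesis is invariant under [lam -> - lam], so the one-sided tail also applies to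
    [- X]; the factor 2 is the union of the two. *)
Lemma subgaussian_tail (X : T -> R) (r u : R) :
  measurable_fun setT X -> (0 < r)%R -> (0 < u)%R ->
  (forall lam : R, \int[P]_w (expR (lam * X w))%:E
                     <= (expR (lam ^+ 2 * r ^+ 2 / 2))%:E) ->
  P [set w | (u <= `|X w|)%R] <= (2 * expR (- (u ^+ 2 / (2 * r ^+ 2))))%:E.
Proof.
move=> mX r0 u0 mgf.
have mNX : measurable_fun setT (fun w => - X w)%R by exact: measurable_funN.
rewrite abs_ge_setE.
apply: le_trans (measureU2 _ (measurable_ge u mX) (measurable_ge u mNX)) _.
rewrite mulrDl mul1r EFinD; apply: leeD; apply: subgaussian_upper_tail => // lam.
have := mgf (- lam)%R; rewrite sqrrN => /(le_trans _); apply.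
by under eq_integral do rewrite mulrN -mulNr.
Qed.

Lemma nneseries_le (f : nat -> \bar R) (c : \bar R) : (forall n, 0 <= f n) ->
  (forall n, \sum_(0 <= i < n) f i <= c) -> \sum_(0 <= i <oo) f i <= c.
Proof.
move=> f0 fc; apply: lime_le; first exact: is_cvg_nneseries.
by apply: nearW.
Qed.

(** Each term is [c / (i+1) - c / (i+2)]. *)
Lemma telescoping_series_le (c : R) n : (0 <= c)%R ->
  \sum_(0 <= i < n) (c / (i.+1%:R * i.+2%:R))%:E <= c%:E.
Proof.
move=> c0; rewrite sumEFin lee_fin.
suff -> : (\sum_(0 <= i < n) c / (i.+1%:R * i.+2%:R) = c - c / n.+1%:R)%R.
  by rewrite gerBl divr_ge0.
elim: n => [|n IH]; first by rewrite big_geq // divr1 subrr.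
rewrite big_nat_recr //= IH -[n.+2]addn1 natrD.
have n0 : (n.+1%:R != 0 :> R)%R by rewrite pnatr_eq0.
have n1 : (n.+1%:R + 1 != 0 :> R)%R by rewrite natr1 pnatr_eq0.
by move: (n.+1%:R : R) n0 n1 => a n0 n1; field; rewrite n0 n1.
Qed.

(** Testing [cond_subgaussian] on the whole space yields the unconditional moment bound. *)
Lemma past_sigma_setT d (X : nat -> T -> 'cV[R]_d) (eta : nat -> T -> R) t :
  past_sigma X eta t setT.
Proof. by rewrite -[setT]setD0; move=> B [[B0 BD _] _]; exact: BD. Qed.

(* The [u^2] at which the two-sided tail [2 exp (- u^2 / (2 r^2))] equals
   [delta / (s (s + 1))], a sequence that sums to [delta] over [s >= 1]. *)
Definition noise_radius2 (delta r : R) (s : nat) : R :=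
  (r ^+ 2 * (2 * ln (2 * (s%:R * s.+1%:R) / delta)))%R.

Lemma noise_radius2_gt0 delta r s : (0 < delta < 1)%R -> (0 < r)%R -> (1 <= s)%N ->
  (0 < noise_radius2 delta r s)%R.
Proof.
move=> /andP[d0 d1] r0 s1.
rewrite mulr_gt0 ?exprn_gt0 // mulr_gt0 // ln_gt0 // ltr_pdivlMr // mul1r.
have : (1 <= (s * s.+1)%:R :> R)%R by rewrite ler1n muln_gt0 s1.
rewrite natrM; lra.
Qed.

Lemma subgaussian_uniform (eta : nat -> T -> R) (r delta : R) :
  (0 < r)%R -> (0 < delta < 1)%R ->
  (forall s, measurable_fun setT (eta s)) ->
  (forall s, (1 <= s)%N -> forall lam : R, \int[P]_w (expR (lam * eta s w))%:E
                     <= (expR (lam ^+ 2 * r ^+ 2 / 2))%:E) ->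
  exists E : set T, [/\ measurable E, (1 - delta)%:E <= P E &
    forall w, E w -> forall s, (1 <= s)%N -> (eta s w ^+ 2 <= noise_radius2 delta r s)%R].
Proof.
move=> r0 d01 meta mgf; have /andP[d0 d1] := d01.
pose u s : R := Num.sqrt (noise_radius2 delta r s).
(* [F n] is the bad event of round [n + 1], as rounds start at 1; the good event is the complement
   of their union. *)
pose F n := [set w | (u n.+1 <= `|eta n.+1 w|)%R].
have mF n : measurable (F n) by apply: measurable_abs_ge.
have mU : measurable (\bigcup_n F n) by exact: bigcup_measurable.
have PF n : P (F n) <= (delta / (n.+1%:R * n.+2%:R))%:E.
  have v0 := noise_radius2_gt0 d01 r0 (ltn0Sn n).
  apply: le_trans (subgaussian_tail (meta _) r0 _ (mgf _ _)) _ => //.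
    by rewrite sqrtr_gt0.
  rewrite lee_fin sqr_sqrtr ?(ltW v0) // /noise_radius2.
  set q := (2 * _ / delta)%R.
  have q0 : (0 < q)%R by rewrite divr_gt0 // mulr_gt0 // mulr_gt0.
  have -> : (r ^+ 2 * (2 * ln q) / (2 * r ^+ 2) = ln q)%R.
    by field; rewrite gt_eqF.
  rewrite expRN lnK ?posrE // /q le_eqVlt; apply/orP; left; apply/eqP.
  by field; rewrite !gt_eqF.
exists (~` (\bigcup_n F n)); split; first exact: measurableC.
  rewrite probability_setC // EFinB leeB //.
  apply: le_trans (measure_sigma_subadditive P mF mU (fun _ h => h)) _.
  apply: nneseries_le => // n.
  apply: le_trans (telescoping_series_le n (ltW d0)).
  by apply: lee_sum => i _; exact: PF.
move=> w Ew [//|s] _.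
have : ~ F s w by move=> Fw; apply: Ew; exists s.
move=> /negP; rewrite -ltNge => /ltW h.
have v0 := noise_radius2_gt0 d01 r0 (ltn0Sn s).
rewrite -[leRHS](sqr_sqrtr (ltW v0)) -[leLHS]real_normK ?num_real //.
by rewrite ler_sqr // nnegrE ?sqrtr_ge0.
Qed.

(** The 3 comes from [s (s + 1) <= t^3], the quotient by [ln 2] from absorbing [ln (2 / delta)] into
    [ln t]. *)
Lemma noise_radius2_le delta r s t : (0 < delta < 1)%R -> (1 <= s <= t)%N -> (2 <= t)%N ->
  (noise_radius2 delta r s
     <= 2 * (ln (2 / delta) / ln 2 + 3) * (r ^+ 2 * ln t%:R))%R.
Proof.
move=> /andP[d0 d1] /andP[s1 st] t2.
rewrite /noise_radius2 [leRHS](_ : _ =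
  r ^+ 2 * (2 * ((ln (2 / delta) / ln 2 + 3) * ln t%:R)))%R; last by ring.
rewrite ler_wpM2l ?sqr_ge0 // ler_pM2l //.
have ln2 : (0 < ln 2 :> R)%R by apply: ln_gt0; lra.
have t0 : (0 < t%:R :> R)%R by rewrite ltr0n (ltnW t2).
have lnt : (ln 2 <= ln t%:R :> R)%R by rewrite ler_ln ?posrE ?ler_nat.
have sst : (s * s.+1 <= t ^ 3)%N.
  rewrite (expnS _ 2) leq_mul // (leq_trans _ (_ : t.*2 <= _)%N) //.
    by rewrite -addnn -addn1 leq_add // (leq_trans s1).
  by rewrite -mul2n expnS expn1 leq_mul2r t2 orbT.
have c0 : (0 < 2 / delta)%R by rewrite divr_gt0.
rewrite mulrAC lnM ?posrE //; last by rewrite mulr_gt0 ?ltr0n.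
rewrite [leRHS]mulrDl lerD //.
  rewrite mulrAC ler_pdivlMr // ler_wpM2l // ln_ge0 // ler_pdivlMr //; lra.
rewrite [leRHS]mulr_natl -lnXn // ler_ln ?posrE ?exprn_gt0 //; last by rewrite mulr_gt0 ?ltr0n.
by rewrite -natrM -natrX ler_nat.
Qed.

End Tail.

(** * Assembly of the regret bound and the two noise regimes *)

Theorem theorem3 (R : realType) (S eps : R) (hS : 0 < S) (heps : 0 < eps) :
  (* (1) the regret bound, for every t >= 1 *)
  (forall (d : nat) (mu m : R -> R) (L kappa : R) (thstar : 'cV[R]_d)
          (x : nat -> 'cV[R]_d) (eta y : nat -> R) (theta : nat -> 'cV[R]_d),
      glm_link S L kappa mu m ->
      glb_data S mu thstar x eta y ->
      ons_run mu kappa eps S x y theta ->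
      forall t : nat, (1 <= t)%N ->
        ons_regret m x y theta thstar t <= B_ons mu kappa eps S x y theta t)
  /\
  (* (2) bounded noise: B_t = O((L^2 + Rbar^2)/kappa * d log t) *)
  (exists C : R,
    forall (d : nat) (mu m : R -> R) (L kappa Rbar : R) (thstar : 'cV[R]_d)
           (x : nat -> 'cV[R]_d) (eta y : nat -> R) (theta : nat -> 'cV[R]_d),
      (1 <= d)%N ->
      glm_link S L kappa mu m ->
      glb_data S mu thstar x eta y ->
      ons_run mu kappa eps S x y theta ->
      (forall s : nat, (1 <= s)%N -> `|eta s| <= Rbar) ->
      forall t : nat, (2 <= t)%N ->
        B_ons mu kappa eps S x y theta t
          <= C * ((L ^+ 2 + Rbar ^+ 2) / kappa * d%:R * ln t%:R))
  /\
  (* (3) sub-Gaussian noise: w.h.p., for all t,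
         B_t = O((L^2 + R^2 log t)/kappa * d log t) *)
  (forall delta : R, 0 < delta < 1 ->
   exists C : R,
    forall (dsp : measure_display) (T : measurableType dsp) (P : probability T R)
           (d : nat) (mu m : R -> R) (L kappa Rs : R) (thstar : 'cV[R]_d)
           (X : nat -> T -> 'cV[R]_d) (eta y : nat -> T -> R)
           (theta : T -> nat -> 'cV[R]_d),
      (1 <= d)%N -> 0 < Rs ->
      glm_link S L kappa mu m ->
      (forall (s : nat) (i : 'I_d), measurable_fun setT (fun w => X s w i ord0)) ->
      (forall s : nat, measurable_fun setT (eta s)) ->
      cond_subgaussian P X eta Rs ->
      (forall w : T, glb_data S mu thstar (X^~ w) (eta^~ w) (y^~ w)
                     /\ ons_run mu kappa eps S (X^~ w) (y^~ w) (theta w)) ->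
      exists E : set T,
        [/\ measurable E, ((1 - delta)%:E <= P E)%E &
            forall w, E w -> forall t : nat, (2 <= t)%N ->
              B_ons mu kappa eps S (X^~ w) (y^~ w) (theta w) t
                <= C * ((L ^+ 2 + Rs ^+ 2 * ln t%:R) / kappa * d%:R * ln t%:R)]).
Proof.
split; [|split].
- move=> d mu m L kappa thstar x eta y theta link [thS [x1 _]] run t _.
  exact: (ons_regret_le heps hS link thS x1 run).
(* The witness is fixed by unification with the prefactor of [B_ons_le], applied with
   [H = Rbar^2]. *)
- eexists => d mu m L kappa Rbar thstar x eta y theta d1 link data run etaR t t2.
  have [_ [x1 _]] := data.
  apply: (B_ons_le heps x1 hS link data run d1 t2) => s /andP[s1 _].
  rewrite -[leLHS]real_normK ?num_real // lerXn2r ?nnegrE ?etaR //.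
  exact: le_trans (etaR s s1).
- move=> delta d01; have /andP[d0 dlt1] := d01.
  set c := (4 * S ^+ 2 + 1) * (1 + ln (1 + eps^-1) / ln 2) + 2 * S ^+ 2 * eps / ln 2.
  set c' := 2 * (ln (2 / delta) / ln 2 + 3).
  have ln2 : 0 < ln 2 :> R by apply: ln_gt0; lra.
  have c0 : 0 <= c.
    have e0 : 0 <= eps^-1 by rewrite invr_ge0 ltW.
    rewrite /c addr_ge0 // mulr_ge0 ?invr_ge0 ?(ltW ln2) //.
    + by rewrite addr_ge0 // mulr_ge0 ?sqr_ge0.
    + by rewrite addr_ge0 // divr_ge0 ?(ltW ln2) // ln_ge0 // lerDl.
    + by rewrite mulr_ge0 ?(ltW heps) // mulr_ge0 ?sqr_ge0.
  (* With [c' >= 1], [L^2 + c' Rs^2 ln t <= c' (L^2 + Rs^2 ln t)], so [c'] factors out. *)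
  have c1 : 1 <= c'.
    have : 0 <= ln (2 / delta) / ln 2.
      by rewrite divr_ge0 ?(ltW ln2) // ln_ge0 // ler_pdivlMr //; lra.
    by rewrite /c'; lra.
  exists (c * c') => dsp T P d mu m L kappa Rs thstar X eta y theta d1 Rs0 link _ meta
    sub run.
  have mgf s : (1 <= s)%N -> forall lam : R,
      (\int[P]_w (expR (lam * eta s w))%:E <= (expR (lam ^+ 2 * Rs ^+ 2 / 2))%:E)%E.
    move=> s1 lam; have := sub s s1 lam setT (@past_sigma_setT _ _ _ _ X eta s).
    by rewrite probability_setT mule1.
  have [E [mE PE Eeta]] := subgaussian_uniform Rs0 d01 meta mgf.
  exists E; split => // w Ew t t2; have [data runw] := run w.
  have [_ [x1 _]] := data.
  have etaH s : (1 <= s <= t)%N -> eta s w ^+ 2 <= c' * (Rs ^+ 2 * ln t%:R).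
    move=> st; have /andP[s1 _] := st.
    by apply: le_trans (Eeta w Ew s s1) _; exact: noise_radius2_le.
  apply: le_trans (B_ons_le heps x1 hS link data runw d1 t2 etaH) _.
  rewrite -/c -(mulrA c c') ler_wpM2l //.
  have -> : c' * ((L ^+ 2 + Rs ^+ 2 * ln t%:R) / kappa * d%:R * ln t%:R)
      = c' * (L ^+ 2 + Rs ^+ 2 * ln t%:R) / kappa * d%:R * ln t%:R by rewrite !mulrA.
  have lnt0 : 0 <= ln t%:R :> R by rewrite ln_ge0 // ler1n (ltnW t2).
  rewrite !ler_wpM2r ?invr_ge0 ?(ltW (glm_kappa_gt0 link)) //.
  by rewrite mulrDr lerD2r ler_peMl ?sqr_ge0.
Qed.
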